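(* For every function $f:\{0,1\}^n\to\{0,1\}$ computable by a width-3 read-once branching program of length $n$, there is an integer $0\le k\le n$ and a $\mathsf{CNF}^\oplus$ formula $g:\{0,1\}^{n-k}\to\{0,1\}$ such that $\{0^k\circ y: g(y)=1\}\subseteq f^{-1}(1)$ and $\mathbb{E}[g]\ge(\mathbb{E}[f]/n)^{O(1)}$.
   Context: A read-once branching program (ROBP) of width $d$ and length $n$ has vertex set partitioned into layers $V_0\cup\cdots\cup V_n$ with $V_0=\{(0,0)\}$ (start state), $V_t=\{(t,i)\}_{i\in[d]}$ for $1\le t\le n-1$, $V_n=\{(n,1),(n,d)\}$ ($(n,1)$ accepts, $(n,d)$ rejects). Each vertex of $V_t$ ($t<n$) has two out-edges labeled $0$ and $1$ into $V_{t+1}$. On input $x\in\{0,1\}^n$, start at $(0,0)$ and from layer $t$ follow the edge labeled $x_{t+1}$; $x$ is accepted iff the path ends at $(n,1)$. A $\mathsf{CNF}^\oplus$ formula is a conjunction $\bigwedge_i T_i$ where each $T_i$ is a disjunction of literals or a parity of literals, the $T_i$ on pairwise disjoint variables. $0^k\circ y$ denotes concatenation; $\mathbb{E}$ is under the uniform distribution. *)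

(* Defs.v *)
From HB Require Import structures.
From mathcomp Require Import all_boot all_order all_algebra.

Set Implicit Arguments.
Unset Strict Implicit.
Unset Printing Implicit Defensive.

Import Order.TTheory GRing.Theory Num.Theory.
Local Open Scope ring_scope.

(* [in_layer d n t i] says that (t, i) is a vertex of V_t. *)
Definition in_layer (d n t i : nat) : bool :=
  if t == 0%N then i == 0%N
  else if (t < n)%N then (1 <= i <= d)%N
  else (t == n) && ((i == 1%N) || (i == d)).

(* The edge labelled [b] leaving (t, i) enters (t.+1, edge t i b); the values of
   [edge] outside the layers 0, ..., n - 1 play no role. *)
Record robp (d n : nat) := Robp {
  edge : nat -> nat -> bool -> nat;
  edgeP : forall (t i : nat) (b : bool),
    (t < n)%N -> in_layer d n t i -> in_layer d n t.+1 (edge t i b)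
}.

(* [nth false x t] is the bit x_{t+1} when bits are numbered from 1. *)
Fixpoint robp_state (d n : nat) (B : robp d n) (x : n.-tuple bool) (t : nat)
    : nat :=
  if t is t'.+1 then edge B t' (robp_state B x t') (nth false x t') else 0%N.

Definition robp_accepts (d n : nat) (B : robp d n) (x : n.-tuple bool) : bool :=
  robp_state B x n == 1%N.

Definition robp_computable (d n : nat) (f : n.-tuple bool -> bool) : Prop :=
  exists B : robp d n, f =1 robp_accepts B.

(* (v, s) is the variable v when s = false and its negation when s = true. *)
Definition literal (m : nat) : Type := ('I_m * bool)%type.

Definition literal_eval (m : nat) (y : m.-tuple bool) (l : literal m) : bool :=
  tnth y l.1 (+) l.2.

(* An empty disjunction or parity is allowed and is identically false, so
   that the constant 0 is represented for every m. *)
Inductive term (m : nat) :=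
  | OrTerm of seq (literal m)
  | XorTerm of seq (literal m).

Definition term_vars (m : nat) (T : term m) : seq 'I_m :=
  match T with OrTerm ls | XorTerm ls => [seq l.1 | l <- ls] end.

Definition term_eval (m : nat) (y : m.-tuple bool) (T : term m) : bool :=
  match T with
  | OrTerm ls => has (literal_eval y) ls
  | XorTerm ls => \big[addb/false]_(l <- ls) literal_eval y l
  end.

Record cnfxor (m : nat) := CnfXor {
  terms : seq (term m);
  terms_disjoint :
    pairwise (fun T U => [disjoint term_vars T & term_vars U]) terms
}.

Definition cnfxor_eval (m : nat) (g : cnfxor m) (y : m.-tuple bool) : bool :=
  all (term_eval y) (terms g).

Definition zeros_cat (n k : nat) (hk : (k <= n)%N) (y : (n - k).-tuple bool)
    : n.-tuple bool :=
  tcast (subnKC hk) [tuple of nseq k false ++ y].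

Definition expectation (n : nat) (h : n.-tuple bool -> bool) : rat :=
  (\sum_(x : n.-tuple bool) (h x)%:R) / #|{: n.-tuple bool}|%:R.

(* Main.v *)
(** Let [eps = E f] and let [k < n] be the largest layer all of whose vertices
    accept with probability at least [eps (1 - k / n)]. With [theta = eps (1 -
    (k + 1) / n)], every later layer has a vertex of acceptance probability at
    most [theta], while the vertex reached by [0^k] accepts with probability
    at least [theta + eps / n]. Subtract [theta] from all acceptance
    probabilities: each later layer then has a vertex that may be treated as
    dead, and what is left is a program of width 2 with sudden death.

    For the two other vertices [X], [Y] of a layer, backward induction on the
    layers builds formulas inside their accepting sets whose probability is at
    least the [C]-th power of (an upper bound on) the acceptance probability.
    The five shapes of [mode] suffice: a common formula; two formulas with
    room to spare; [h /\ pi] and [h /\ ~ pi] for a parity [pi]; a vertex [Y]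
    at most 2/3 as good as [X]; and [h], [h /\ T] for a clause [T]. Whenever a
    layer loses a constant factor in the formula, either the acceptance
    probability drops by a constant factor, which a large exponent [C]
    amortizes, or the room to spare of the current shape is used up, and it
    can only be needed again after another such drop. *)

Require Import Defs.
From HB Require Import structures.
From mathcomp Require Import all_boot all_order all_algebra.
From mathcomp Require Import lra ring zify.

Set Implicit Arguments.
Unset Strict Implicit.
Unset Printing Implicit Defensive.

Import Order.TTheory GRing.Theory Num.Theory.
Local Open Scope ring_scope.

(** * Uniform expectation and its split along the first bit *)

Lemma neq_negb (b c : bool) : c != b -> c = ~~ b.
Proof. by case: b c => [] []. Qed.

Lemma eq_expectation m (h1 h2 : m.-tuple bool -> bool) :
  h1 =1 h2 -> expectation h1 = expectation h2.
Proof. by move=> eq_h; congr (_ / _); apply: eq_bigr => x _; rewrite eq_h. Qed.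

Lemma expectation0 m : expectation (fun _ : m.-tuple bool => false) = 0.
Proof. by rewrite /expectation big1 ?mul0r. Qed.

Lemma expectation_nil (h : 0.-tuple bool -> bool) :
  expectation h = (h [tuple])%:R.
Proof.
rewrite /expectation card_tuple expn0 divr1 (big_pred1 [tuple]) // => x.
by apply/esym/eqP; exact: tuple0.
Qed.

Lemma expectation_cons m (h : m.+1.-tuple bool -> bool) :
  expectation h =
    (expectation (fun y : m.-tuple bool => h [tuple of false :: y])
     + expectation (fun y : m.-tuple bool => h [tuple of true :: y])) / 2.
Proof.
have ->: expectation h =
    (\sum_(p : bool * m.-tuple bool) (h [tuple of p.1 :: p.2])%:R)
      / #|{: m.+1.-tuple bool}|%:R.
  congr (_ / _).
  rewrite (reindex (fun p : bool * m.-tuple bool => [tuple of p.1 :: p.2])) //=.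
  exists (fun x : m.+1.-tuple bool => (thead x, [tuple of behead x])).
    by move=> [b y] _; congr pair; apply: val_inj.
  by move=> x _; rewrite -tuple_eta.
rewrite -(pair_bigA _
  (fun (b : bool) (y : m.-tuple bool) => (h [tuple of b :: y])%:R)).
rewrite /= big_bool /=.
rewrite /expectation !card_tuple card_bool expnS natrM.
have nz : ((2 ^ m)%:R : rat) != 0 by rewrite pnatr_eq0 expn_eq0.
by field.
Qed.

(** * Formulas moved past a new first variable *)

Definition liftl m (l : literal m) : literal m.+1 := (lift ord0 l.1, l.2).

Definition liftt m (T : term m) : term m.+1 :=
  match T with
  | OrTerm ls => OrTerm (map (@liftl m) ls)
  | XorTerm ls => XorTerm (map (@liftl m) ls)
  end.

Definition liftf m (g : seq (term m)) : seq (term m.+1) := map (@liftt m) g.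

(** The flag of a literal marks negation, so this literal is true exactly when the first bit is
    [b]. *)
Definition lit0 m (b : bool) : literal m.+1 := (ord0, ~~ b).

Definition wf m (g : seq (term m)) : bool :=
  pairwise (fun T U => [disjoint term_vars T & term_vars U]) g.

Definition holds m (g : seq (term m)) (y : m.-tuple bool) : bool :=
  all (term_eval y) g.

Definition and_lit m (b : bool) (g : seq (term m)) : seq (term m.+1) :=
  OrTerm [:: lit0 m b] :: liftf g.

Lemma liftl_eval m (b : bool) (y : m.-tuple bool) (l : literal m) :
  literal_eval [tuple of b :: y] (liftl l) = literal_eval y l.
Proof. by rewrite /literal_eval /= tnthS. Qed.

Lemma lit0_eval m (b c : bool) (y : m.-tuple bool) :
  literal_eval [tuple of c :: y] (lit0 m b) = (c == b).
Proof. by rewrite /literal_eval /= tnth0; case: b c => [] []. Qed.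

Lemma or_lift_eval m (b : bool) (y : m.-tuple bool) (ls : seq (literal m)) :
  has (literal_eval [tuple of b :: y]) (map (@liftl m) ls)
    = has (literal_eval y) ls.
Proof. by rewrite has_map; apply: eq_has => l /=; rewrite liftl_eval. Qed.

Lemma xor_lift_eval m (b : bool) (y : m.-tuple bool) (ls : seq (literal m)) :
  \big[addb/false]_(l <- map (@liftl m) ls) literal_eval [tuple of b :: y] l
    = \big[addb/false]_(l <- ls) literal_eval y l.
Proof. by rewrite big_map; apply: eq_bigr => l _; rewrite liftl_eval. Qed.

Lemma liftf_holds m (b : bool) (y : m.-tuple bool) (g : seq (term m)) :
  holds (liftf g) [tuple of b :: y] = holds g y.
Proof.
rewrite /holds all_map; apply: eq_all => -[] ls /=.
  exact: or_lift_eval.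
exact: xor_lift_eval.
Qed.

Lemma and_lit_holds m (b c : bool) (y : m.-tuple bool) (g : seq (term m)) :
  holds (and_lit b g) [tuple of c :: y] = (c == b) && holds g y.
Proof.
have -> : holds (and_lit b g) [tuple of c :: y] =
    (literal_eval [tuple of c :: y] (lit0 m b) || false)
      && holds (liftf g) [tuple of c :: y] by [].
by rewrite lit0_eval orbF liftf_holds.
Qed.

Lemma liftt_vars m (T : term m) :
  term_vars (liftt T) = map (lift ord0) (term_vars T).
Proof. by case: T => ls /=; rewrite -!map_comp. Qed.

Lemma disjoint_lift m (s t : seq 'I_m) :
  [disjoint map (lift ord0) s & map (lift ord0) t] = [disjoint s & t].
Proof.
rewrite !disjoint_has has_map; congr (~~ _); apply: eq_has => i /=.
by rewrite mem_map //; apply: lift_inj.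
Qed.

Lemma liftf_wf m (g : seq (term m)) : wf (liftf g) = wf g.
Proof.
rewrite /wf pairwise_map; apply: eq_pairwise => T U.
rewrite -[LHS]/[disjoint term_vars (liftt T) & term_vars (liftt U)].
by rewrite !liftt_vars disjoint_lift.
Qed.

(** The variable [ord0] is outside the range of [lift ord0], so adding it to one lifted term keeps
    the terms disjoint. *)
Lemma cons_lift_wf m (T' : term m.+1) (T : term m) (g : seq (term m)) :
  term_vars T' = ord0 :: map (lift ord0) (term_vars T) ->
  wf (T' :: liftf g) = wf (T :: g).
Proof.
move=> varsT'; rewrite /wf /= -/(wf _) liftf_wf; congr (_ && _).
rewrite all_map; apply: eq_all => U.
rewrite -[LHS]/[disjoint term_vars T' & term_vars (liftt U)] varsT'.
rewrite liftt_vars disjoint_cons disjoint_lift.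
suff -> : ord0 \notin map (lift ord0) (term_vars U) by [].
by apply/mapP => -[i _ /eqP]; rewrite (negPf (neq_lift _ _)).
Qed.

(** With the empty clause as [T], [cons_lift_wf] also handles a term made of the new literal
    alone. *)
Lemma wf_cons_nil m (g : seq (term m)) : wf (OrTerm [::] :: g) = wf g.
Proof.
rewrite /wf /= andb_idl // => _.
by rewrite (@eq_all _ _ predT) ?all_predT // => U /=; rewrite disjoint_has.
Qed.

Lemma and_lit_wf m (b : bool) (g : seq (term m)) : wf (and_lit b g) = wf g.
Proof. by rewrite -(wf_cons_nil g); apply: cons_lift_wf. Qed.

Lemma wf_behead m (T : term m) (g : seq (term m)) : wf (T :: g) -> wf g.
Proof. by rewrite /wf /= => /andP[]. Qed.

Lemma expectation_liftf m (g : seq (term m)) :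
  expectation (holds (liftf g)) = expectation (holds g).
Proof.
rewrite expectation_cons !(eq_expectation (fun y => liftf_holds _ y g)).
by field.
Qed.

Lemma expectation_and_lit m (b : bool) (g : seq (term m)) :
  expectation (holds (and_lit b g)) = expectation (holds g) / 2.
Proof.
rewrite expectation_cons !(eq_expectation (fun y => and_lit_holds b _ y g)).
by case: b; rewrite expectation0; field.
Qed.

(** * The exponent and the gain *)

Lemma mulr_exprM (k a b c : rat) (n : nat) : a * b = c ->
  k * a ^+ n * b ^+ n = k * c ^+ n.
Proof. by move=> <-; rewrite exprMn mulrA. Qed.

Lemma expr16E (x : rat) : x ^+ 16 = (((x ^+ 2) ^+ 2) ^+ 2) ^+ 2.
Proof. by rewrite -!exprM. Qed.

(** Four squarings, with rounding after each, keep the rationals small. *)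
Lemma expr16_le (x a b c d : rat) : 0 <= x -> x ^+ 2 <= a -> a ^+ 2 <= b ->
  b ^+ 2 <= c -> c ^+ 2 <= d -> x ^+ 16 <= d.
Proof.
have sq (u v w : rat) : u ^+ 2 <= v -> v ^+ 2 <= w -> (u ^+ 2) ^+ 2 <= w.
  move=> uv; apply: le_trans; apply: lerXn2r;
  by rewrite ?nnegrE ?(le_trans _ uv) ?sqr_ge0.
rewrite expr16E => x0 xa ab bc cd; have /sq /(_ bc) := sq _ _ _ xa ab.
by move=> /sq; apply.
Qed.

Lemma expr16_ge (x a b c d : rat) : 0 <= a -> 0 <= b -> 0 <= c ->
  a <= x ^+ 2 -> b <= a ^+ 2 -> c <= b ^+ 2 -> d <= c ^+ 2 -> d <= x ^+ 16.
Proof.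
have sq (u v w : rat) :
    0 <= v -> v <= u ^+ 2 -> w <= v ^+ 2 -> w <= (u ^+ 2) ^+ 2.
  move=> v0 uv wv; apply: le_trans wv _.
  by apply: lerXn2r; rewrite ?nnegrE ?sqr_ge0.
rewrite expr16E => a0 b0 c0 xa ab bc cd.
by apply: (sq _ c) => //; apply: (sq _ b) => //; apply: (sq _ a).
Qed.

(* The gain [K] must outweigh the ratios 2/3 and 3/5 of two values after raising
   to the power [C], and yet be covered by halving a value once. *)
Lemma constants :
  {C : nat & {K : rat | [/\ (0 < C)%N, 4 <= K, K * (1/2) ^+ C <= 1/2
    & [/\ 4 * (9/10 : rat) ^+ C <= 1, 4 <= K * (2/3) ^+ C,
          2 <= K * (3/5) ^+ C
    & forall d : rat, 0 <= d <= 1/2 -> (1 - d / 6) ^+ C <= 1 - d]]}}.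
Proof.
(* [C] stays abstract so that its powers remain symbolic; 16 is a power of two large enough for all
   the bounds. *)
have [C eC] : {C | C = 16%N} by exists 16%N.
have p53 : 2 <= (5/3 : rat) ^+ C.
  by rewrite eC; apply: (@expr16_ge _ 2 2 2); lra.
have p56 : (5/6 : rat) ^+ C <= 1/4.
  by rewrite eC; apply: (@expr16_le _ (7/10) (1/2) (1/4)); lra.
have p910 : (9/10 : rat) ^+ C <= 1/4.
  by rewrite eC; apply: (@expr16_le _ (81/100) (2/3) (1/2)); lra.
have p109 : 4 <= (10/9 : rat) ^+ C.
  by rewrite eC; apply: (@expr16_ge _ (123/100) (3/2) 2); lra.
(* Multiplying this gain by the powers of [1/2], [2/3] and [3/5] gives twice the powers of [5/6],
   [10/9] and [1]. *)
exists C, (2 * (5/3) ^+ C); split; [by rewrite eC | by lra | | split].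
- by rewrite (@mulr_exprM _ _ _ (5/6)); lra.
- by lra.
- by rewrite (@mulr_exprM _ _ _ (10/9)); lra.
- by rewrite (@mulr_exprM _ _ _ 1) ?expr1n; lra.
clear -eC; rewrite {}eC => d /andP[d0 d1].
have dpos : 0 <= 1 - d / 6 by lra.
rewrite expr16E.
(* On [0 <= d <= 1/2] the square of a linear bound lies under its chord, which is rounded up to the
   next linear bound. *)
have s1 : 0 <= (1 - d/6) ^+ 2 <= 1 - 3/10 * d.
  by apply/andP; split; [exact: exprn_ge0 | rewrite expr2; nra].
have s2 : 0 <= ((1 - d/6) ^+ 2) ^+ 2 <= 1 - 55/100 * d.
  move: s1; move: (_ ^+ 2) => x; case/andP=> a b;
  apply/andP; split; [exact: exprn_ge0 | rewrite expr2; nra].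
have s3 : 0 <= (((1 - d/6) ^+ 2) ^+ 2) ^+ 2 <= 1 - 9/10 * d.
  move: s2; move: (_ ^+ 2) => x; case/andP=> a b;
  apply/andP; split; [exact: exprn_ge0 | rewrite expr2; nra].
by move: s3; move: (_ ^+ 2) => x; case/andP=> a b; rewrite expr2; nra.
Qed.
Definition expo : nat := projT1 constants.

Definition gain : rat := projT1 (projT2 constants).

Lemma expo_gt0 : (0 < expo)%N.
Proof. by case: (projT2 (projT2 constants)). Qed.

Lemma gain_ge4 : 4 <= gain.
Proof. by case: (projT2 (projT2 constants)). Qed.

Lemma gain_half : gain * (1/2) ^+ expo <= 1/2.
Proof. by case: (projT2 (projT2 constants)). Qed.

Lemma pow_9_10 : 4 * (9/10 : rat) ^+ expo <= 1.
Proof. by case: (projT2 (projT2 constants)) => _ _ _ []. Qed.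

Lemma gain_2_3 : 4 <= gain * (2/3) ^+ expo.
Proof. by case: (projT2 (projT2 constants)) => _ _ _ []. Qed.

Lemma gain_3_5 : 2 <= gain * (3/5) ^+ expo.
Proof. by case: (projT2 (projT2 constants)) => _ _ _ []. Qed.

Lemma pow_clause (d : rat) : 0 <= d <= 1/2 -> (1 - d / 6) ^+ expo <= 1 - d.
Proof. by case: (projT2 (projT2 constants)) => _ _ _ [_ _ _]; apply. Qed.

Lemma expo_mono (a b : rat) : 0 <= a -> a <= b -> a ^+ expo <= b ^+ expo.
Proof. by move=> a0 ab; apply: lerXn2r; rewrite ?nnegrE ?(le_trans a0 ab). Qed.

Lemma expo_ge0 (a : rat) : 0 <= a -> 0 <= a ^+ expo.
Proof. exact: exprn_ge0. Qed.

(** * Values above the threshold and the modes of a pair *)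

Section Modes.

Variable theta : rat.

Definition value m (S : m.-tuple bool -> bool) : rat := expectation S - theta.

Definition implies m (g : seq (term m)) (S : m.-tuple bool -> bool) : Prop :=
  forall y, holds g y -> S y.

(** [P] only bounds the value from above: two sets can then share a bound, and powers stay monotone
    even if a value is negative. The factor [c] is the room to spare that pays for literals fixed
    later. *)
Definition covers (c : rat) m (S : m.-tuple bool -> bool) (P : rat) : Prop :=
  [/\ 0 <= P, value S <= P & exists g : seq (term m),
    [/\ wf g, implies g S & c * P ^+ expo <= expectation (holds g)]].

Definition branch m (S : m.+1.-tuple bool -> bool) (b : bool) :
  m.-tuple bool -> bool := fun y => S [tuple of b :: y].

Definition negl m (l : literal m) : literal m := (l.1, ~~ l.2).

(** In [Dual], negating the leading literal complements the parity. In [Clause], the clause removes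
    at most a fraction [d] of [h], against a gap of [d / 3] in value. A vertex with one edge to each
    of [X] and [Y] keeps the gap [d / 6], which [pow_clause] converts into the factor [1 - d]. *)
Inductive mode m (X Y : m.-tuple bool -> bool) : Prop :=
| Merged P g of 0 <= P & value X <= P & value Y <= P & wf g
    & implies g X & implies g Y & P ^+ expo <= expectation (holds g)
| Balanced P of covers 4 X P & covers 4 Y P
| Dual P l ls h of 0 <= P & value X <= P & value Y <= P
    & wf (XorTerm (l :: ls) :: h)
    & implies (XorTerm (l :: ls) :: h) X
    & implies (XorTerm (negl l :: ls) :: h) Y
    & 2 * P ^+ expo <= expectation (holds (XorTerm (l :: ls) :: h))
    & 2 * P ^+ expo <= expectation (holds (XorTerm (negl l :: ls) :: h))
| Half P Q of Q <= 2/3 * P & covers 1 X P & covers gain Y Q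
| Clause P d ls h of 0 <= P & 0 <= d <= 1/2 & value X <= P
    & value Y <= (1 - d / 3) * P & wf (OrTerm ls :: h)
    & implies h X & implies (OrTerm ls :: h) Y
    & P ^+ expo <= expectation (holds h)
    & (1 - d) * expectation (holds h)
        <= expectation (holds (OrTerm ls :: h)).

(** [Half] and [Clause] are not symmetric in the two sets, so either order is accepted. *)
Definition good m (X Y : m.-tuple bool -> bool) : Prop := mode X Y \/ mode Y X.

(** Here [S] belongs to a vertex one layer before [X] and [Y], with both edges into this pair. *)
Inductive alive m (X Y : m.-tuple bool -> bool) (S : m.+1.-tuple bool -> bool)
    : Prop :=
| ToLeft of forall b, branch S b =1 X
| ToRight of forall b, branch S b =1 Y
| ToBoth b of branch S b =1 X & branch S (~~ b) =1 Y.

(** At least one edge of [S] may be treated as leading to a dead vertex; [DeadBoth] records only the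
    effect on the value of [S]. *)
Inductive dead m (X Y : m.-tuple bool -> bool) (S : m.+1.-tuple bool -> bool)
    : Prop :=
| DeadBoth of value S <= 0
| DeadLeft b of branch S b =1 X & value (branch S (~~ b)) <= 0
| DeadRight b of branch S b =1 Y & value (branch S (~~ b)) <= 0.

(** * Values and covers one layer earlier *)

Lemma eq_value m (S T : m.-tuple bool -> bool) : S =1 T -> value S = value T.
Proof. by move=> eqST; rewrite /value (eq_expectation eqST). Qed.

Lemma value_branch m (S : m.+1.-tuple bool -> bool) (b : bool) :
  value S = (value (branch S b) + value (branch S (~~ b))) / 2.
Proof. by rewrite /value expectation_cons /branch; case: b => /=; field. Qed.

Lemma covers_le c c' m (S : m.-tuple bool -> bool) P :
  c <= c' -> covers c' S P -> covers c S P.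
Proof.
move=> cc' [P0 vS [g [wg gS Eg]]]; split=> //; exists g; split=> //.
by apply: le_trans Eg; rewrite ler_wpM2r // expo_ge0.
Qed.

Lemma implies_liftf m (g : seq (term m)) (S : m.+1.-tuple bool -> bool) :
  (forall b, implies g (branch S b)) -> implies (liftf g) S.
Proof.
move=> gS y; case/tupleP: y => b y; rewrite liftf_holds; exact: gS.
Qed.

Lemma implies_and_lit m b (g : seq (term m)) (S : m.+1.-tuple bool -> bool) :
  implies g (branch S b) -> implies (and_lit b g) S.
Proof.
move=> gS y; case/tupleP: y => c y; rewrite and_lit_holds => /andP[/eqP-> gy].
exact: gS.
Qed.

Lemma implies_eq m (g : seq (term m)) (S T : m.-tuple bool -> bool) :
  T =1 S -> implies g S -> implies g T.
Proof. by move=> eqST gS y gy; rewrite eqST; apply: gS. Qed.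

Lemma covers_lift c m (U : m.-tuple bool -> bool) (S : m.+1.-tuple bool -> bool)
    P : (forall b, branch S b =1 U) -> covers c U P -> covers c S P.
Proof.
move=> SU [P0 vU [g [wg gU Eg]]]; split=> //.
  by rewrite (value_branch _ true) !(eq_value (SU _)); lra.
exists (liftf g); split; rewrite ?liftf_wf ?expectation_liftf //.
by apply: implies_liftf => b; apply: implies_eq gU.
Qed.

Lemma covers_lit c c' m (U : m.-tuple bool -> bool)
    (S : m.+1.-tuple bool -> bool) P R b :
  branch S b =1 U -> covers c U P -> 0 <= R -> value S <= R ->
  2 * (c' * R ^+ expo) <= c * P ^+ expo -> covers c' S R.
Proof.
move=> SU [P0 vU [g [wg gU Eg]]] R0 vS cRP; split=> //.
exists (and_lit b g); split; rewrite ?and_lit_wf ?expectation_and_lit //.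
  by apply: implies_and_lit; apply: implies_eq gU.
by lra.
Qed.

(** One bit leads to a set of value at most [0], so the bound halves and its power shrinks by
    [2 ^+ expo]. This pays for fixing the other bit and still leaves the factor [gain]. *)
Lemma covers_dead m (U : m.-tuple bool -> bool) (S : m.+1.-tuple bool -> bool)
    P b : branch S b =1 U -> value (branch S (~~ b)) <= 0 -> covers 1 U P ->
  covers gain S (P / 2).
Proof.
move=> SU vD cU; have [P0 vU _] := cU.
apply: (covers_lit SU cU); first by lra.
  by rewrite (value_branch _ b) (eq_value SU); lra.
have -> : P / 2 = 1/2 * P by lra.
rewrite exprMn mulrA.
by have := expo_ge0 P0; have := gain_half; nra.
Qed.

Lemma dead_covers m (X Y : m.-tuple bool -> bool)
    (S : m.+1.-tuple bool -> bool) P PX PY :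
  dead X Y S -> PX <= P -> covers 1 X PX -> PY <= P -> covers 1 Y PY ->
  exists2 Q, Q <= P / 2 & covers gain S Q.
Proof.
move=> dS XP cX YP cY; have [PX0 _ _] := cX; have [PY0 _ _] := cY.
case: dS => [vS | b SX vD | b SY vD].
(* The bound [0] is met by the false formula, because [expo] is positive. *)
- exists 0; first by lra.
  split=> //; exists [:: OrTerm [::]]; split=> //.
  by rewrite expr0n gtn_eqF ?expo_gt0 // mulr0 expectation0.
- by exists (PX / 2); [lra | apply: covers_dead SX vD cX].
- by exists (PY / 2); [lra | apply: covers_dead SY vD cY].
Qed.

(* If one of the two bounds is much smaller than the other we are in mode
   [Half]; otherwise the large gain absorbs their ratio. *)
Lemma strong_good m (X Y : m.-tuple bool -> bool) P Q :
  covers gain X P -> covers gain Y Q -> good X Y.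
Proof.
wlog QP : X Y P Q / Q <= P.
  move=> wl cX cY; case: (leP Q P) => QP; first exact: wl cX cY.
  by case: (wl Y X Q P (ltW QP) cY cX) => ?; [right | left].
move=> cX cY; have gain4 := gain_ge4; left.
have [QleP | PltQ] := leP Q (2/3 * P).
  by apply: (Half QleP) => //; apply: covers_le cX; lra.
have [P0 vX _] := cX; have [Q0 vY [g [wg gY Eg]]] := cY.
apply: (@Balanced _ _ _ P); first exact: covers_le cX.
split=> //; first by lra.
exists g; split=> //; apply: le_trans Eg.
have PQ : (2/3 * P) ^+ expo <= Q ^+ expo by apply: expo_mono; lra.
rewrite exprMn in PQ; have P1 := expo_ge0 P0; have g23 := gain_2_3.
apply: (@le_trans _ _ (gain * ((2/3) ^+ expo * P ^+ expo))).
  by rewrite mulrA; apply: ler_wpM2r.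
by apply: ler_wpM2l => //; lra.
Qed.

(** * Modes created or extended by the bit just read *)

Lemma merged_lit m (U : m.-tuple bool -> bool)
    (S1 S2 : m.+1.-tuple bool -> bool) b (c P R : rat) :
  branch S1 b =1 U -> branch S2 b =1 U -> covers c U P ->
  0 <= R -> value S1 <= R -> value S2 <= R ->
  2 * R ^+ expo <= c * P ^+ expo -> mode S1 S2.
Proof.
move=> S1U S2U [P0 vU [g [wg gU Eg]]] R0 v1 v2 RP.
apply: (@Merged _ _ _ R (and_lit b g)) => //.
- by rewrite and_lit_wf.
- by apply: implies_and_lit; apply: implies_eq gU.
- by apply: implies_and_lit; apply: implies_eq gU.
by rewrite expectation_and_lit; lra.
Qed.

Lemma xor_lit_holds m (b c : bool) (y : m.-tuple bool) (h : seq (term m)) :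
  (holds (XorTerm [:: lit0 m b] :: liftf h) [tuple of c :: y]
     = (c == b) && holds h y) *
  (holds (XorTerm [:: negl (lit0 m b)] :: liftf h) [tuple of c :: y]
     = (c != b) && holds h y).
Proof.
rewrite -(liftf_holds c y h); split.
  have -> : holds (XorTerm [:: lit0 m b] :: liftf h) [tuple of c :: y] =
    term_eval [tuple of c :: y] (XorTerm [:: lit0 m b])
      && holds (liftf h) [tuple of c :: y] by [].
  by rewrite /= big_seq1 lit0_eval.
have -> : holds (XorTerm [:: negl (lit0 m b)] :: liftf h) [tuple of c :: y] =
  term_eval [tuple of c :: y] (XorTerm [:: negl (lit0 m b)])
    && holds (liftf h) [tuple of c :: y] by [].
rewrite /= big_seq1 /literal_eval /= tnth0.
by case: b c => [] [].
Qed.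

(** The two vertices reach [U] on opposite bits, so the new bit alone is the parity. Fixing it costs
    a factor 2, and [Dual] asks for another factor 2. *)
Lemma dual_lit m (U : m.-tuple bool -> bool)
    (S1 S2 : m.+1.-tuple bool -> bool) b (c P R : rat) :
  branch S1 b =1 U -> branch S2 (~~ b) =1 U -> covers c U P ->
  0 <= R -> value S1 <= R -> value S2 <= R ->
  4 * R ^+ expo <= c * P ^+ expo -> mode S1 S2.
Proof.
move=> S1U S2U [P0 vU [g [wg gU Eg]]] R0 v1 v2 RP.
have eE (l : literal m.+1) (u : bool) :
    (forall (c : bool) (y : m.-tuple bool),
       holds (XorTerm [:: l] :: liftf g) [tuple of c :: y]
         = (c == u) && holds g y) ->
    2 * R ^+ expo <= expectation (holds (XorTerm [:: l] :: liftf g)).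
  move=> hl; rewrite expectation_cons !(eq_expectation (hl _)).
  by case: u {hl}; rewrite expectation0; lra.
apply: (@Dual _ _ _ R (lit0 m b) [::] (liftf g)) => //.
- by rewrite (@cons_lift_wf _ _ (OrTerm [::])) // wf_cons_nil.
- move=> y; case/tupleP: y => d y; rewrite xor_lit_holds => /andP[/eqP-> gy].
  by rewrite -/(branch S1 b y) S1U; apply: gU.
- move=> y; case/tupleP: y => d y; rewrite xor_lit_holds => /andP[nd gy].
  have -> : d = ~~ b by case: d b nd {S1U S2U} => [] [].
  by rewrite -/(branch S2 (~~ b) y) S2U; apply: gU.
- by apply: (eE _ b) => d y; rewrite xor_lit_holds.
- apply: (eE _ (~~ b)) => d y; rewrite xor_lit_holds.
  by case: d b {S1U S2U} => [] [].
Qed.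

Lemma value_both m (X Y : m.-tuple bool -> bool) (S : m.+1.-tuple bool -> bool)
    P Q b : branch S b =1 X -> branch S (~~ b) =1 Y ->
  value X <= P -> value Y <= Q -> value S <= (P + Q) / 2.
Proof.
move=> SX SY vX vY.
by rewrite (value_branch _ b) (eq_value SX) (eq_value SY); lra.
Qed.

Lemma value_same m (U : m.-tuple bool -> bool) (S : m.+1.-tuple bool -> bool) :
  (forall b, branch S b =1 U) -> value S = value U.
Proof.
by move=> SU; rewrite (value_branch _ true) !(eq_value (SU _)); field.
Qed.

Lemma value_alive m (X Y : m.-tuple bool -> bool)
    (S : m.+1.-tuple bool -> bool) P :
  alive X Y S -> value X <= P -> value Y <= P -> value S <= P.
Proof.
case=> [SX | SY | b SX SY] vX vY; rewrite ?(value_same SX) ?(value_same SY) //.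
by have := value_both SX SY vX vY; lra.
Qed.

Lemma implies_alive m (X Y : m.-tuple bool -> bool)
    (S : m.+1.-tuple bool -> bool) g :
  alive X Y S -> implies g X -> implies g Y -> implies (liftf g) S.
Proof.
move=> aS gX gY; apply: implies_liftf => c.
case: aS => [SX | SY | b SX SY].
- exact: implies_eq gX.
- exact: implies_eq gY.
have [-> | ncb] := eqVneq c b; first exact: implies_eq gX.
suff -> : c = ~~ b by exact: implies_eq gY.
by case: c b ncb {SX SY} => [] [].
Qed.

Lemma alive_sym m (X Y : m.-tuple bool -> bool) (S : m.+1.-tuple bool -> bool) :
  alive X Y S -> alive Y X S.
Proof.
case=> [SX | SY | b SX SY]; [exact: ToRight | exact: ToLeft |].
by apply: (@ToBoth _ _ _ _ (~~ b)); rewrite ?negbK.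
Qed.

Lemma dead_sym m (X Y : m.-tuple bool -> bool) (S : m.+1.-tuple bool -> bool) :
  dead X Y S -> dead Y X S.
Proof.
by case=> [vS | b SX vD | b SY vD];
  [exact: DeadBoth | apply: DeadRight SX vD | apply: DeadLeft SY vD].
Qed.

Lemma or_lit_holds m (b c : bool) (y : m.-tuple bool) ls (h : seq (term m)) :
  holds (OrTerm (lit0 m b :: map (@liftl m) ls) :: liftf h) [tuple of c :: y]
    = if c == b then holds h y else holds (OrTerm ls :: h) y.
Proof.
rewrite -(liftf_holds c y h).
have -> : holds (OrTerm (lit0 m b :: map (@liftl m) ls) :: liftf h)
    [tuple of c :: y]
  = (literal_eval [tuple of c :: y] (lit0 m b)
       || has (literal_eval [tuple of c :: y]) (map (@liftl m) ls))
     && holds (liftf h) [tuple of c :: y] by [].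
rewrite lit0_eval or_lift_eval liftf_holds.
by case: eqP.
Qed.

(** A first bit equal to [b] makes the new literal true and so flips the rest of the parity, which
    amounts to negating its leading literal. *)
Lemma xor_cons_holds m (b c : bool) (y : m.-tuple bool) l ls
    (h : seq (term m)) :
  holds (XorTerm (lit0 m b :: map (@liftl m) (l :: ls)) :: liftf h)
      [tuple of c :: y]
    = holds (XorTerm ((if c == b then negl l else l) :: ls) :: h) y.
Proof.
have -> : holds (XorTerm (lit0 m b :: map (@liftl m) (l :: ls)) :: liftf h)
    [tuple of c :: y]
  = \big[addb/false]_(k <- lit0 m b :: map (@liftl m) (l :: ls))
       literal_eval [tuple of c :: y] k
     && holds (liftf h) [tuple of c :: y] by [].
rewrite big_cons xor_lift_eval liftf_holds lit0_eval big_cons.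
rewrite /holds /= big_cons; case: eqP => _ //=; congr (_ && _).
rewrite /literal_eval /=.
by case: (tnth _ _) l.2 (\big[_/_]_(_ <- _) _) => [] [] [].
Qed.

Lemma clause_mean (d A B : rat) :
  (1 - d) * A <= B -> (1 - d / 2) * A <= (A + B) / 2.
Proof. by move=> ?; lra. Qed.

Lemma or_lit_mode m (X Y : m.-tuple bool -> bool)
    (S1 S2 : m.+1.-tuple bool -> bool) (P d : rat) ls h b :
  0 <= P -> 0 <= d <= 1 -> value S1 <= P -> value S2 <= (1 - d / 6) * P ->
  (forall c, branch S1 c =1 X) -> branch S2 b =1 X -> branch S2 (~~ b) =1 Y ->
  wf (OrTerm ls :: h) -> implies h X -> implies (OrTerm ls :: h) Y ->
  P ^+ expo <= expectation (holds h) ->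
  (1 - d) * expectation (holds h) <= expectation (holds (OrTerm ls :: h)) ->
  mode S1 S2.
Proof.
move=> P0 /andP[d0 d1] v1 v2 S1X S2X S2Y wT hX TY Ph dT.
apply: (@Clause _ _ _ P (d / 2) (lit0 m b :: map (@liftl m) ls) (liftf h)).
- by [].
- by lra.
- by [].
- by apply: le_trans v2 _; rewrite ler_wpM2r //; lra.
- rewrite (@cons_lift_wf _ _ (OrTerm ls)) //=.
  by rewrite -!map_comp.
- by apply: implies_liftf => c; apply: implies_eq hX.
- move=> y; case/tupleP: y => c y; rewrite or_lit_holds.
  have [-> | /neq_negb-> ] := eqVneq c b => hy.
    by rewrite -/(branch S2 b y) S2X; apply: hX.
  by rewrite -/(branch S2 (~~ b) y) S2Y; apply: TY.
- by rewrite expectation_liftf.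
rewrite expectation_liftf [leRHS]expectation_cons.
rewrite !(eq_expectation (fun y => or_lit_holds b _ y ls h)).
case: b {S2X S2Y} => /=; rewrite -/(holds h) -/(holds (OrTerm ls :: h)).
  by rewrite [X in _ <= X / 2]addrC; apply: clause_mean.
exact: clause_mean.
Qed.

(** * Two alive vertices, for each mode of the next layer *)

Lemma merged_lift m (X Y : m.-tuple bool -> bool)
    (S1 S2 : m.+1.-tuple bool -> bool) (P : rat) g :
  alive X Y S1 -> alive X Y S2 -> wf g -> implies g X -> implies g Y ->
  0 <= P -> value S1 <= P -> value S2 <= P ->
  P ^+ expo <= expectation (holds g) -> mode S1 S2.
Proof.
move=> a1 a2 wg gX gY P0 v1 v2 Pg; apply: (@Merged _ _ _ P (liftf g)) => //.
- by rewrite liftf_wf.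
- exact: implies_alive gX gY.
- exact: implies_alive gX gY.
by rewrite expectation_liftf.
Qed.

(** A vertex with one edge to each set has value at most [5/6 * P]. Relaxing this to [9/10 * P]
    lowers the power by a factor 4, enough for [merged_lit] or [dual_lit]. *)
Lemma half_alive m (X Y : m.-tuple bool -> bool)
    (S1 S2 : m.+1.-tuple bool -> bool) (P Q : rat) :
  Q <= 2/3 * P -> covers 1 X P -> covers gain Y Q ->
  alive X Y S1 -> alive X Y S2 -> good S1 S2.
Proof.
move=> QP cX cY a1 a2.
have [P0 vX [g [wg gX Eg]]] := cX; have [Q0 vY [k [wk kY Ek]]] := cY.
have gain4 := gain_ge4; have P910 := pow_9_10; have PC := expo_ge0 P0.
have vboth S b : branch S b =1 X -> branch S (~~ b) =1 Y -> value S <= 5/6 * P.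
  by move=> SX SY; have := value_both SX SY vX vY; lra.
have toXY S1' S2' b : (forall c, branch S1' c =1 X) ->
    branch S2' b =1 X -> branch S2' (~~ b) =1 Y -> good S1' S2'.
  move=> S1X S2X S2Y; left.
  (* The clause starts empty, hence false with [d = 1]; then [(1 - d / 6) * P] is [5/6 * P]. *)
  apply: (@or_lit_mode _ X Y _ _ P 1 [::] g b).
  - exact: P0.
  - by lra.
  - by rewrite (value_same S1X).
  - by have := vboth _ _ S2X S2Y; lra.
  - exact: S1X.
  - exact: S2X.
  - exact: S2Y.
  - by rewrite wf_cons_nil.
  - exact: gX.
  - by [].
  - by rewrite -[P ^+ _]mul1r.
  - have E0 : (fun y => holds (OrTerm [::] :: g) y) =1 (fun _ => false) by [].
    by rewrite (eq_expectation E0) expectation0; lra.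
have toYX S1' S2' : (forall c, branch S1' c =1 X) ->
    (forall c, branch S2' c =1 Y) -> good S1' S2'.
  move=> S1X S2Y; left; apply: (Half QP); first exact: covers_lift cX.
  exact: covers_lift cY.
have toBY S1' S2' b : branch S1' b =1 X -> branch S1' (~~ b) =1 Y ->
    (forall c, branch S2' c =1 Y) -> good S1' S2'.
  move=> S1X S1Y S2Y; left; have v1 := value_both S1X S1Y vX vY.
  (* Since [3/5 = 2/3 * 9/10], a small [Q] keeps [Half] with the bound [9/10 * P]. Otherwise the
     gain of [Y] outweighs the ratio of [Q] to [P], and both vertices merge along their common edge
     to [Y]. *)
  have [QleP | PltQ] := leP Q (3/5 * P).
    apply: (@Half _ _ _ (9/10 * P) Q); first by lra.
      apply: (covers_lit S1X cX); [by lra | by lra |].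
      by rewrite exprMn; nra.
    exact: covers_lift cY.
  apply: (merged_lit S1Y (S2Y (~~ b)) cY P0); first by lra.
    by rewrite (value_same S2Y); lra.
  have PQ : (3/5 * P) ^+ expo <= Q ^+ expo by apply: expo_mono; lra.
  rewrite exprMn in PQ.
  apply: (@le_trans _ _ (gain * ((3/5) ^+ expo * P ^+ expo))).
    by rewrite mulrA; apply: ler_wpM2r => //; apply: gain_3_5.
  by apply: ler_wpM2l => //; lra.
have PQC : Q ^+ expo <= P ^+ expo by apply: expo_mono; lra.
case: a1 a2 => [S1X | S1Y | b S1X S1Y] [S2X | S2Y | c S2X S2Y].
- left; apply: (@merged_lift _ X X _ _ P g) => //;
    rewrite ?(value_same S1X) ?(value_same S2X) //; try exact: ToLeft.
  by lra.
- exact: toYX.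
- exact: toXY S2X S2Y.
- by case: (toYX _ _ S2X S1Y); [right | left].
- left; apply: (@merged_lift _ Y Y _ _ Q k) => //;
    rewrite ?(value_same S1Y) ?(value_same S2Y) //; try exact: ToLeft.
  by have := expo_ge0 Q0; nra.
- by case: (toBY _ _ _ S2X S2Y S1Y); [right | left].
- by case: (toXY _ _ _ S2X S1X S1Y); [right | left].
- exact: toBY S1X S1Y S2Y.
have v1 := vboth _ _ S1X S1Y; have v2 := vboth _ _ S2X S2Y; left.
have [bc | /neq_negb bc] := eqVneq b c.
  rewrite bc in S1X; apply: (merged_lit (R := 9/10 * P) S1X S2X cX).
  - by lra.
  - by lra.
  - by lra.
  by rewrite exprMn; have := @expo_ge0 (9/10); nra.
apply: (dual_lit (R := 9/10 * P) S1X (S2 := S2) _ cX).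
- by rewrite bc negbK.
- by lra.
- by lra.
- by lra.
by rewrite exprMn; nra.
Qed.

Lemma liftf_covers m (X Y : m.-tuple bool -> bool)
    (S : m.+1.-tuple bool -> bool) (P : rat) g :
  alive X Y S -> wf g -> implies g X -> implies g Y ->
  0 <= P -> value S <= P -> P ^+ expo <= expectation (holds g) ->
  covers 1 S P.
Proof.
move=> aS wg gX gY P0 vS Pg; split=> //; exists (liftf g).
split; rewrite ?liftf_wf ?expectation_liftf ?mul1r //.
exact: implies_alive gX gY.
Qed.

Lemma clause_pow (P d A B : rat) : 0 <= P -> 0 <= d <= 1/2 ->
  P ^+ expo <= A -> (1 - d) * A <= B -> ((1 - d / 6) * P) ^+ expo <= B.
Proof.
move=> P0 d01 PA dAB; rewrite exprMn; apply: le_trans dAB.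
have /andP[d0 d1] := d01.
by apply: ler_pM => //; rewrite ?pow_clause ?expo_ge0 //; lra.
Qed.

(** If one vertex always moves to [X] and the other can reach [Y], the clause is kept or extended.
    If neither always moves to [X], both values have dropped enough for the clause formula to serve
    both. *)
Lemma clause_alive m (X Y : m.-tuple bool -> bool)
    (S1 S2 : m.+1.-tuple bool -> bool) (P d : rat) ls h :
  0 <= P -> 0 <= d <= 1/2 -> value X <= P -> value Y <= (1 - d / 3) * P ->
  wf (OrTerm ls :: h) -> implies h X -> implies (OrTerm ls :: h) Y ->
  P ^+ expo <= expectation (holds h) ->
  (1 - d) * expectation (holds h) <= expectation (holds (OrTerm ls :: h)) ->
  alive X Y S1 -> alive X Y S2 -> good S1 S2.
Proof.
move=> P0 d01 vX vY wT hX TY Ph dT a1 a2; have /andP[d0 d1] := d01.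
have dP0 : 0 <= d * P by apply: mulr_ge0.
have dPP : d * P <= 1/2 * P by apply: ler_wpM2r.
have TX : implies (OrTerm ls :: h) X.
  by move=> y /andP[_ hy]; apply: hX.
have vB S b : branch S b =1 X -> branch S (~~ b) =1 Y ->
    value S <= (1 - d / 6) * P.
  by move=> SX SY; have := value_both SX SY vX vY; lra.
have toXY S1' S2' b : (forall c, branch S1' c =1 X) ->
    branch S2' b =1 X -> branch S2' (~~ b) =1 Y -> good S1' S2'.
  move=> S1X S2X S2Y; left.
  apply: (@or_lit_mode _ X Y _ _ P d ls h b) => //.
  - by lra.
  - by rewrite (value_same S1X).
  - exact: vB S2X S2Y.
have toYX S1' S2' : (forall c, branch S1' c =1 X) ->
    (forall c, branch S2' c =1 Y) -> good S1' S2'.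
  move=> S1X S2Y; left.
  apply: (@Clause _ _ _ P d (map (@liftl m) ls) (liftf h)) => //.
  - by rewrite (value_same S1X).
  - by rewrite (value_same S2Y).
  - by rewrite -[X in wf X]/(liftf (OrTerm ls :: h)) liftf_wf.
  - by apply: implies_liftf => c; apply: implies_eq hX.
  - rewrite -[X in implies X]/(liftf (OrTerm ls :: h)).
    by apply: implies_liftf => c; apply: implies_eq TY.
  - by rewrite expectation_liftf.
  by rewrite -[X in _ <= expectation (holds X)]/(liftf (OrTerm ls :: h))
    !expectation_liftf.
have merged : value S1 <= (1 - d / 6) * P -> value S2 <= (1 - d / 6) * P ->
    good S1 S2.
  move=> v1 v2; left.
  apply: (@merged_lift _ X Y _ _ ((1 - d / 6) * P) (OrTerm ls :: h)) => //.
    by lra.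
  exact: clause_pow dT.
case: a1 a2 merged => [S1X | S1Y | b S1X S1Y] [S2X | S2Y | c S2X S2Y] merged.
- left; apply: (@merged_lift _ X X _ _ P h);
    rewrite ?(value_same S1X) ?(value_same S2X) //; try exact: ToLeft.
  exact: wf_behead wT.
- exact: toYX.
- exact: toXY S2X S2Y.
- by case: (toYX _ _ S2X S1Y); [right | left].
- by apply: merged; rewrite ?(value_same S1Y) ?(value_same S2Y); lra.
- apply: merged; last exact: vB S2X S2Y.
  by rewrite (value_same S1Y); lra.
- by case: (toXY _ _ _ S2X S1X S1Y); [right | left].
- apply: merged; first exact: vB S1X S1Y.
  by rewrite (value_same S2Y); lra.
by apply: merged; [exact: vB S1X S1Y | exact: vB S2X S2Y].
Qed.

(** If some bit sends both vertices to the same set, fixing that bit merges them at the cost of the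
    factor 2. Otherwise their edges are parallel or swapped. *)
Lemma shared_or_crossed m (X Y : m.-tuple bool -> bool)
    (S1 S2 : m.+1.-tuple bool -> bool) (P : rat) :
  covers 2 X P -> covers 2 Y P -> alive X Y S1 -> alive X Y S2 ->
  [\/ mode S1 S2,
      (forall b, branch S1 b =1 X) /\ (forall b, branch S2 b =1 Y),
      (forall b, branch S1 b =1 Y) /\ (forall b, branch S2 b =1 X)
    | exists b, [/\ branch S1 b =1 X, branch S1 (~~ b) =1 Y,
        branch S2 b =1 Y & branch S2 (~~ b) =1 X]].
Proof.
move=> cX cY a1 a2; have [P0 vX _] := cX; have [_ vY _] := cY.
have v1 := value_alive a1 vX vY; have v2 := value_alive a2 vX vY.
have shared U b : covers 2 U P -> branch S1 b =1 U -> branch S2 b =1 U ->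
    mode S1 S2.
  by move=> cU S1U S2U; apply: (merged_lit S1U S2U cU P0).
case: a1 a2 => [S1X | S1Y | b S1X S1Y] [S2X | S2Y | c S2X S2Y].
- by apply: Or41; apply: (shared X true).
- exact: Or42.
- by apply: Or41; apply: (shared X c).
- exact: Or43.
- by apply: Or41; apply: (shared Y true).
- by apply: Or41; apply: (shared Y (~~ c)).
- by apply: Or41; apply: (shared X b).
- by apply: Or41; apply: (shared Y (~~ b)).
have [bc | /neq_negb bc] := eqVneq b c.
  by rewrite -bc in S2X; apply: Or41; apply: (shared X b).
apply: Or44; exists b; split=> //; by rewrite bc ?negbK.
Qed.

Lemma balanced_alive m (X Y : m.-tuple bool -> bool)
    (S1 S2 : m.+1.-tuple bool -> bool) (P : rat) :
  covers 4 X P -> covers 4 Y P -> alive X Y S1 -> alive X Y S2 -> good S1 S2.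
Proof.
move=> cX cY a1 a2; have [P0 vX _] := cX; have [_ vY _] := cY; left.
have le24 : 2 <= 4 :> rat by [].
case: (shared_or_crossed (covers_le le24 cX) (covers_le le24 cY) a1 a2).
- by [].
- case=> S1X S2Y.
  apply: (Balanced (P := P)); first exact: covers_lift cX.
  exact: covers_lift cY.
- case=> S1Y S2X.
  apply: (Balanced (P := P)); first exact: covers_lift cY.
  exact: covers_lift cX.
case=> b [S1X S1Y S2Y S2X]; apply: (dual_lit S1X S2X cX P0) => //.
- exact: value_alive a1 vX vY.
- exact: value_alive a2 vX vY.
Qed.

(** Swapped edges add the new bit to the parity instead of fixing it. The new probability is the
    average of the two old ones, so nothing is lost. *)
Lemma dual_alive m (X Y : m.-tuple bool -> bool)
    (S1 S2 : m.+1.-tuple bool -> bool) (P : rat) l ls h :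
  0 <= P -> value X <= P -> value Y <= P ->
  wf (XorTerm (l :: ls) :: h) -> implies (XorTerm (l :: ls) :: h) X ->
  implies (XorTerm (negl l :: ls) :: h) Y ->
  2 * P ^+ expo <= expectation (holds (XorTerm (l :: ls) :: h)) ->
  2 * P ^+ expo <= expectation (holds (XorTerm (negl l :: ls) :: h)) ->
  alive X Y S1 -> alive X Y S2 -> good S1 S2.
Proof.
move=> P0 vX vY wl lX nlY El Enl a1 a2.
have cX : covers 2 X P by split=> //; exists (XorTerm (l :: ls) :: h).
have cY : covers 2 Y P by split=> //; exists (XorTerm (negl l :: ls) :: h).
have straight S1' S2' : (forall b, branch S1' b =1 X) ->
    (forall b, branch S2' b =1 Y) -> mode S1' S2'.
  move=> S1X S2Y.
  apply: (@Dual _ _ _ P (liftl l) (map (@liftl m) ls) (liftf h)) => //.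
  - by rewrite (value_same S1X).
  - by rewrite (value_same S2Y).
  - by rewrite -[X in wf X]/(liftf (XorTerm (l :: ls) :: h)) liftf_wf.
  - rewrite -[X in implies X]/(liftf (XorTerm (l :: ls) :: h)).
    by apply: implies_liftf => c; apply: implies_eq lX.
  - rewrite -[X in implies X]/(liftf (XorTerm (negl l :: ls) :: h)).
    by apply: implies_liftf => c; apply: implies_eq nlY.
  - rewrite -[X in holds X]/(liftf (XorTerm (l :: ls) :: h)).
    by rewrite expectation_liftf.
  rewrite -[X in holds X]/(liftf (XorTerm (negl l :: ls) :: h)).
  by rewrite expectation_liftf.
case: (shared_or_crossed cX cY a1 a2).
- by left.
- by case=> S1X S2Y; left; apply: straight.
- by case=> S1Y S2X; right; apply: straight.
case=> b [S1X S1Y S2Y S2X]; left.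
have hE (c : bool) :
    2 * P ^+ expo <= expectation
      (holds (XorTerm (lit0 m c :: map (@liftl m) (l :: ls)) :: liftf h)).
  rewrite expectation_cons.
  rewrite !(eq_expectation (fun y => xor_cons_holds c _ y l ls h)).
  by case: c => /=; rewrite -/(holds (XorTerm (l :: ls) :: h))
    -/(holds (XorTerm (negl l :: ls) :: h)); lra.
have nE : negl (lit0 m (~~ b)) = lit0 m b by rewrite /negl /lit0 /= negbK.
have bE' : (b == ~~ b) = false by case: (b).
(* The new literal is false at the bit [b], where [S1] moves to [X] and the old parity must hold
   unchanged. *)
apply: (@Dual _ _ _ P (lit0 m (~~ b)) (map (@liftl m) (l :: ls)) (liftf h));
  rewrite ?nE //.
- exact: value_alive a1 vX vY.
- exact: value_alive a2 vX vY.
- rewrite (@cons_lift_wf _ _ (XorTerm (l :: ls))) //=.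
  by rewrite -!map_comp.
- move=> y; case/tupleP: y => c y; rewrite xor_cons_holds.
  have [-> | /neq_negb-> ] := eqVneq c b => hy.
    by rewrite -/(branch S1 b y) S1X; apply: lX; rewrite bE' in hy.
  by rewrite -/(branch S1 (~~ b) y) S1Y; apply: nlY; rewrite eqxx in hy.
- move=> y; case/tupleP: y => c y; rewrite xor_cons_holds.
  have [-> | /neq_negb-> ] := eqVneq c b => hy.
    by rewrite -/(branch S2 b y) S2Y; apply: nlY.
  by rewrite -/(branch S2 (~~ b) y) S2X; apply: lX.
Qed.

Lemma mode_alive m (X Y : m.-tuple bool -> bool)
    (S1 S2 : m.+1.-tuple bool -> bool) :
  mode X Y -> alive X Y S1 -> alive X Y S2 -> good S1 S2.
Proof.
case=> [P g P0 vX vY wg gX gY Eg | P cX cY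
  | P l ls h P0 vX vY wl lX nlY El Enl | P Q QP cX cY
  | P d ls h P0 d01 vX vY wT hX TY Ph dT] a1 a2.
- left; apply: (merged_lift a1 a2 wg gX gY P0) => //.
    exact: value_alive a1 vX vY.
  exact: value_alive a2 vX vY.
- exact: balanced_alive cX cY a1 a2.
- exact: (dual_alive P0 vX vY wl).
- exact: half_alive QP cX cY a1 a2.
exact: (clause_alive P0 d01 vX vY wT).
Qed.

(** * Steps that involve a dead vertex *)

(** A dead vertex will have bound at most [P / 2 = 2/3 * (3/4 * P)], with full gain. An alive vertex
    with bound at least [3/4 * P] then gives [Half], and one with full gain gives [strong_good]. *)
Lemma mode_one_alive m (X Y : m.-tuple bool -> bool) : mode X Y ->
  exists P, [/\ exists2 PX, PX <= P & covers 1 X PX,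
    exists2 PY, PY <= P & covers 1 Y PY
    & forall S, alive X Y S ->
        (exists2 R, 3/4 * P <= R & covers 1 S R) \/
        (exists R, covers gain S R)].
Proof.
have lit_alive (c P : rat) : 2 <= c -> covers c X P -> covers c Y P ->
    forall S, alive X Y S -> covers 1 S P.
  move=> c2 cX cY S aS; have [P0 vX _] := cX; have [_ vY _] := cY.
  have vS := value_alive aS vX vY; have PC := expo_ge0 P0.
  case: aS => [SX | SY | b SX _].
  - by apply: (covers_lit (SX true) cX P0 vS); nra.
  - by apply: (covers_lit (SY true) cY P0 vS); nra.
  - by apply: (covers_lit SX cX P0 vS); nra.
have le1 (c : rat) (Z : m.-tuple bool -> bool) (P : rat) :
    2 <= c -> covers c Z P -> covers 1 Z P.
  by move=> c2; apply: covers_le; lra.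
case=> [P g P0 vX vY wg gX gY Eg | P cX cY
  | P l ls h P0 vX vY wl lX nlY El Enl | P Q QP cX cY
  | P d ls h P0 d01 vX vY wT hX TY Ph dT]; exists P.
- have cov Z : implies g Z -> value Z <= P -> covers 1 Z P.
    by move=> gZ vZ; split=> //; exists g; rewrite mul1r.
  split; [by exists P; [lra | exact: cov] | by exists P; [lra | exact: cov] |].
  move=> S aS; left; exists P; first by lra.
  by apply: (liftf_covers aS wg) => //; apply: value_alive aS vX vY.
- have [P0 _ _] := cX.
  split; first by exists P; [lra | apply: le1 cX].
    by exists P; [lra | apply: le1 cY].
  by move=> S aS; left; exists P; [lra | apply: (lit_alive 4)].
- have cX : covers 2 X P by split=> //; exists (XorTerm (l :: ls) :: h).
  have cY : covers 2 Y P by split=> //; exists (XorTerm (negl l :: ls) :: h).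
  split; first by exists P; [lra | apply: le1 cX].
    by exists P; [lra | apply: le1 cY].
  by move=> S aS; left; exists P; [lra | apply: (lit_alive 2)].
- have [P0 vX _] := cX; have [Q0 vY _] := cY; have gain4 := gain_ge4.
  split.
  + by exists P; [lra | apply: covers_le cX].
  + by exists Q; [lra | apply: covers_le cY; lra].
  move=> S [SX | SY | b SX SY].
  + by left; exists P; [lra | apply: covers_lift cX].
  + by right; exists Q; apply: covers_lift cY.
  left; exists (9/10 * P); first by lra.
  have vS := value_both SX SY vX vY.
  apply: (covers_lit SX cX); [by lra | by lra |].
  by rewrite exprMn; have := pow_9_10; have := expo_ge0 P0; nra.
have /andP[d0 d1] := d01; have dP0 : 0 <= d * P by apply: mulr_ge0.
have dPP : d * P <= 1/2 * P by apply: ler_wpM2r.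
have TX : implies (OrTerm ls :: h) X.
  by move=> y /andP[_ hy]; apply: hX.
have dC := clause_pow P0 d01 Ph dT.
split.
- exists P; first by [].
  by split=> //; exists h; rewrite mul1r; split=> //; apply: wf_behead wT.
- exists ((1 - d / 6) * P); first by lra.
  split; [by lra | by lra |].
  by exists (OrTerm ls :: h); rewrite mul1r.
move=> S aS; left; case: (aS) => [SX | SY | b SX SY].
- exists P; first by lra.
  apply: (@liftf_covers _ X X _ P h) => //; first exact: ToLeft.
    exact: wf_behead wT.
  by rewrite (value_same SX).
- exists ((1 - d / 6) * P); first by lra.
  apply: (liftf_covers aS wT) => //; first by lra.
  by rewrite (value_same SY); lra.
exists ((1 - d / 6) * P); first by lra.
apply: (liftf_covers aS wT) => //; first by lra.
by have := value_both SX SY vX vY; lra.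
Qed.

Lemma alive_dead_good m (X Y : m.-tuple bool -> bool)
    (S1 S2 : m.+1.-tuple bool -> bool) :
  mode X Y -> alive X Y S1 -> dead X Y S2 -> good S1 S2.
Proof.
move=> /mode_one_alive[P [[PX PXP cX] [PY PYP cY] aP]] a1 d2.
have [Q QP cS2] := dead_covers d2 PXP cX PYP cY.
case: (aP _ a1) => [[R PR cS1] | [R cS1]]; last exact: strong_good cS1 cS2.
by left; apply: (Half _ cS1 cS2); lra.
Qed.

Lemma good_sym m (X Y : m.-tuple bool -> bool) : good X Y -> good Y X.
Proof. by case; [right | left]. Qed.

Lemma good_step m (X Y : m.-tuple bool -> bool)
    (S1 S2 : m.+1.-tuple bool -> bool) :
  good X Y -> alive X Y S1 \/ dead X Y S1 -> alive X Y S2 \/ dead X Y S2 ->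
  good S1 S2.
Proof.
wlog mXY : X Y / mode X Y.
  move=> wl [mXY | mYX] s1 s2; first exact: (wl X Y mXY (or_introl mXY)).
  apply: (wl Y X mYX (or_introl mYX)).
    by case: s1 => [/alive_sym | /dead_sym] ?; [left | right].
  by case: s2 => [/alive_sym | /dead_sym] ?; [left | right].
move=> _ [a1 | d1] [a2 | d2].
- exact: mode_alive mXY a1 a2.
- exact: alive_dead_good mXY a1 d2.
- by apply: good_sym; apply: alive_dead_good mXY a2 d1.
have [P [[PX PXP cX] [PY PYP cY] _]] := mode_one_alive mXY.
have [Q1 _ c1] := dead_covers d1 PXP cX PYP cY.
have [Q2 _ c2] := dead_covers d2 PXP cX PYP cY.
exact: strong_good c1 c2.
Qed.

Lemma good_covers m (X : m.-tuple bool -> bool) :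
  good X X -> exists P, covers 1 X P.
Proof.
by case=> /mode_one_alive[P [[PX _ cX] _ _]]; exists PX.
Qed.

End Modes.

(** * Backward induction over the layers of a program *)

Section Programs.

Variables (n : nat) (B : robp 3 n).

Fixpoint accepts_from (t i : nat) (y : seq bool) : bool :=
  if y is b :: y' then accepts_from t.+1 (edge B t i b) y' else i == 1%N.

(* [m] is the number of remaining layers, so [i] is read as the vertex
   (n - m, i). *)
Definition from m (i : nat) : m.-tuple bool -> bool :=
  fun y => accepts_from (n - m) i y.

Lemma in_layer_gt0 t i : (0 < t)%N -> in_layer 3 n t i -> (1 <= i <= 3)%N.
Proof.
rewrite /in_layer; case: t => // t _ /=; case: ifP => // _.
by case/andP=> _ /orP[] /eqP->.
Qed.

Lemma in_layer_inner t i : (0 < t < n)%N -> in_layer 3 n t i = (1 <= i <= 3)%N.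
Proof. by rewrite /in_layer; case: t => // t /= ->. Qed.

Lemma state_in_layer (x : n.-tuple bool) t : (t <= n)%N ->
  in_layer 3 n t (robp_state B x t).
Proof. by elim: t => // t IHt tn; apply: edgeP => //; apply/IHt/ltnW. Qed.

Lemma robp_state_prefix (x x' : n.-tuple bool) t :
  (forall j, (j < t)%N -> nth false x j = nth false x' j) ->
  robp_state B x t = robp_state B x' t.
Proof.
elim: t => //= t IHt eqx; rewrite eqx // IHt // => j jt.
by apply: eqx; apply: ltnW.
Qed.

Lemma accepts_from_state (x : n.-tuple bool) t : (t <= n)%N ->
  accepts_from t (robp_state B x t) (drop t x) = robp_accepts B x.
Proof.
(* The induction is on the number of bits still to be read. *)
move=> tn; rewrite -(subKn tn); have := leq_subr t n.
elim: (n - t)%N => {t tn} [_ | m IHm mn].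
  by rewrite subn0 drop_oversize // size_tuple.
rewrite -IHm; last exact: ltnW.
rewrite -(subnSK mn) (@drop_nth _ false) //.
by rewrite size_tuple ltn_subrL (leq_ltn_trans _ mn).
Qed.

Lemma branch_from m i (b : bool) : (m < n)%N ->
  branch (@from m.+1 i) b =1 from (edge B (n - m.+1) i b).
Proof. by move=> mn y; rewrite /branch /from /= subnSK. Qed.

Lemma edge_range m i (b : bool) : (m < n)%N -> in_layer 3 n (n - m.+1) i ->
  (1 <= edge B (n - m.+1) i b <= 3)%N.
Proof.
move=> mn ti; apply: (@in_layer_gt0 (n - m.+1).+1) => //.
by apply: edgeP ti; lia.
Qed.

Section Threshold.

Variables (theta : rat) (k : nat).

Hypothesis theta_ge0 : 0 <= theta.

Hypothesis has_dead : forall t, (k < t < n)%N ->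
  exists2 D, (1 <= D <= 3)%N & value theta (@from (n - t) D) <= 0.

Lemma alive_or_dead m X Y D i : (m < n)%N ->
  (forall j, (1 <= j <= 3)%N -> [\/ j = X, j = Y | j = D]) ->
  value theta (@from m D) <= 0 -> in_layer 3 n (n - m.+1) i ->
  alive (@from m X) (@from m Y) (@from m.+1 i) \/
  dead theta (@from m X) (@from m Y) (@from m.+1 i).
Proof.
move=> mn XYD vD ti.
have E b := XYD _ (edge_range b mn ti).
have N b := @branch_from m i b mn.
have vN b : edge B (n - m.+1) i b = D ->
    value theta (branch (@from m.+1 i) b) <= 0.
  by move=> eb; rewrite (eq_value theta (N b)) eb.
have [e0 | e0 | e0] := E false; have [e1 | e1 | e1] := E true.
- by left; apply: ToLeft => -[] y; rewrite N ?e0 ?e1.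
- by left; apply: (ToBoth (b := false)) => y; rewrite N ?e0 ?e1.
- right; apply: (@DeadLeft _ _ _ _ _ false); last exact: vN.
  by move=> y; rewrite N e0.
- by left; apply: (ToBoth (b := true)) => y; rewrite N ?e0 ?e1.
- by left; apply: ToRight => -[] y; rewrite N ?e0 ?e1.
- right; apply: (@DeadRight _ _ _ _ _ false); last exact: vN.
  by move=> y; rewrite N e0.
- right; apply: (@DeadLeft _ _ _ _ _ true); last exact: vN.
  by move=> y; rewrite N e1.
- right; apply: (@DeadRight _ _ _ _ _ true); last exact: vN.
  by move=> y; rewrite N e1.
right; apply: DeadBoth; rewrite (value_branch _ _ false).
by have := vN _ e0; have := vN _ e1; lra.
Qed.

Lemma good_layer m : (m < n - k)%N -> exists X Y D,
  [/\ forall j, (1 <= j <= 3)%N -> [\/ j = X, j = Y | j = D],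
      value theta (@from m D) <= 0
    & good theta (@from m X) (@from m Y)].
Proof.
have value1 : value theta (@from 0 1) <= 1.
  rewrite /value (_ : expectation _ = 1) ?expectation_nil //.
  by rewrite gerBl.
have value_reject i : (1 < i)%N -> value theta (@from 0 i) <= 0.
  move=> i1; rewrite /value (_ : expectation _ = 0).
    by rewrite sub0r oppr_le0.
  by rewrite expectation_nil /from /= gtn_eqF.
elim: m => [_ | m IHm mk].
  (* Index [2] is no vertex of the last layer, but read as rejecting it completes the pair: [Half]
     holds with the bounds [1] and [0]. *)
  exists 1%N, 2%N, 3%N; split.
  - by case=> [|[|[|[|j]]]] // _; [apply: Or31 | apply: Or32 | apply: Or33].
  - exact: value_reject.
  left; apply: (@Half _ _ _ _ 1 0); first by lra.
    split=> //; exists [::]; split=> //; last by rewrite expr1n expectation_nil.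
    by move=> y _; rewrite (tuple0 y).
  split=> //; first exact: value_reject.
  exists [:: OrTerm [::]]; split=> //.
  by rewrite expr0n gtn_eqF ?expo_gt0 // mulr0 expectation_nil.
have mn : (m < n)%N by lia.
have [X [Y [D [XYD vD gXY]]]] := IHm (ltnW mk).
have [|D' D'3 vD'] := @has_dead (n - m.+1); first by lia.
have step i : (1 <= i <= 3)%N -> alive (@from m X) (@from m Y) (@from m.+1 i) \/
    dead theta (@from m X) (@from m Y) (@from m.+1 i).
  move=> i3; apply: (alive_or_dead mn XYD vD).
  by rewrite in_layer_inner //; lia.
rewrite subKn in vD'; last by lia.
have [X' [Y' [X'3 Y'3 XYD']]] : exists X' Y', [/\ (1 <= X' <= 3)%N,
    (1 <= Y' <= 3)%N
    & forall j, (1 <= j <= 3)%N -> [\/ j = X', j = Y' | j = D']].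
  case: D' D'3 {vD'} => [|[|[|[|D']]]] // _.
  - exists 2%N, 3%N; split=> // -[|[|[|[|j]]]] // _;
      by [apply: Or31 | apply: Or32 | apply: Or33].
  - exists 1%N, 3%N; split=> // -[|[|[|[|j]]]] // _;
      by [apply: Or31 | apply: Or32 | apply: Or33].
  exists 1%N, 2%N; split=> // -[|[|[|[|j]]]] // _;
    by [apply: Or31 | apply: Or32 | apply: Or33].
exists X', Y', D'; split=> //.
exact: good_step gXY (step _ X'3) (step _ Y'3).
Qed.

(** Layer [k] need not have a dead vertex, but only [s] matters there: the last step from layer
    [k.+1] uses [s] as both members of the pair. *)
Lemma covers_from s : (k < n)%N -> in_layer 3 n k s ->
  exists P, covers theta 1 (@from (n - k) s) P.
Proof.
move=> kn ks; apply: good_covers.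
have mn : ((n - k).-1 < n - k)%N by lia.
have [X [Y [D [XYD vD gXY]]]] := good_layer mn.
have <- : (n - k).-1.+1 = (n - k)%N by lia.
have st : alive (from X) (from Y) (@from (n - k).-1.+1 s) \/
    dead theta (from X) (from Y) (@from (n - k).-1.+1 s).
  apply: (alive_or_dead _ XYD vD); first by lia.
  by rewrite (_ : n - (n - k).-1.+1 = k)%N //; lia.
exact: (good_step gXY st st).
Qed.

End Threshold.

(** * Choice of the layer and the threshold *)

Lemma threshold_exists (eps : rat) : (0 < n)%N ->
  0 <= eps -> eps <= expectation (@from n 0) ->
  exists k theta, [/\ (k < n)%N, 0 <= theta,
    forall t, (k < t < n)%N ->
      exists2 D, (1 <= D <= 3)%N & value theta (@from (n - t) D) <= 0
    & forall s, in_layer 3 n k s ->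
        eps / n%:R <= value theta (@from (n - k) s)].
Proof.
move=> n0 eps0 epsE.
have nR : 0 < n%:R :> rat by rewrite ltr0n.
pose p t := eps * (1 - t%:R / n%:R).
(* [iota 0 4] lists every index in a layer below [n]: [0] at the start and [1] to [3] afterwards. *)
pose Q t := (t < n)%N && all (fun i => in_layer 3 n t i ==>
  (p t <= expectation (@from (n - t) i))) (iota 0 4).
have exQ : exists t, Q t.
  exists 0%N; rewrite /Q n0; apply/allP => i _; apply/implyP.
  rewrite /in_layer /= => /eqP->; rewrite subn0 /p mul0r subr0 mulr1.
  exact: epsE.
have Qn t : Q t -> (t <= n)%N by case/andP=> /ltnW.
case: (ex_maxnP exQ Qn) => k /andP[kn /allP Qk] kmax.
have pS t : (k < t)%N -> p t <= p k.+1.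
  move=> kt; rewrite /p; apply: ler_wpM2l => //; apply: lerB => //.
  by apply: ler_wpM2r; rewrite ?invr_ge0 ?ler0n ?ler_nat.
exists k, (p k.+1); split=> //.
- by rewrite /p mulr_ge0 // subr_ge0 ler_pdivrMr // mul1r ler_nat.
- move=> t /andP[kt tn].
  (* By maximality of [k] some vertex of layer [t] falls below [p t], hence below [p k.+1]. *)
  have : ~~ Q t by apply/negP => /kmax; rewrite leqNgt kt.
  rewrite /Q tn -has_predC => /hasP[i _ /=]; rewrite negb_imply -ltNge.
  case/andP; rewrite in_layer_inner ?tn ?andbT ?(leq_ltn_trans _ kt) //.
  move=> i3 lt_p.
  by exists i => //; rewrite /value; have := pS _ kt; lra.
move=> s ks; have s4 : s \in iota 0 4.
  rewrite mem_iota; case: (posnP k) ks => [-> | k0].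
    by rewrite /in_layer /= => /eqP->.
  by move/(in_layer_gt0 k0); lia.
have := Qk s s4; rewrite ks /= /value => le_p.
have -> : eps / n%:R = p k - p k.+1.
  by rewrite /p -natr1; field; rewrite gt_eqF.
by apply: lerB.
Qed.

End Programs.

(** * Assembly along the all-zero prefix *)

Theorem theorem6p2 :
  exists C : nat,
  forall (n : nat) (f : n.-tuple bool -> bool),
    (0 < n)%N ->
    robp_computable 3 f ->
    exists (k : nat) (hk : (k <= n)%N) (g : cnfxor (n - k)),
      [set zeros_cat hk y | y in [set y | cnfxor_eval g y]]
        \subset [set x | f x]
      /\ (expectation f / n%:R) ^+ C <= expectation (cnfxor_eval g).
Proof.
exists expo => n f n0 [B fB].
have Ef0 : 0 <= expectation f.
  by rewrite /expectation divr_ge0 ?ler0n // sumr_ge0.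
have EfB : expectation f <= expectation (@from n B n 0).
  rewrite (eq_expectation (h2 := @from n B n 0)) // => x.
  by rewrite fB -(accepts_from_state B x (leq0n n)) drop0 /from subnn.
have [k [theta [kn theta0 hasD vk]]] := threshold_exists n0 Ef0 EfB.
pose s := robp_state B (nseq_tuple n false) k.
have ks : in_layer 3 n k s by apply/state_in_layer/ltnW.
have [P [P0 vP [g [wg gs Eg]]]] := covers_from theta0 hasD kn ks.
exists k, (ltnW kn), (CnfXor wg); split.
  apply/subsetP => x /imsetP[y]; rewrite !inE => gy ->; rewrite fB.
  have valx : val (zeros_cat (ltnW kn) y) = nseq k false ++ y.
    by rewrite /zeros_cat /= val_tcast.
  rewrite -(accepts_from_state B _ (ltnW kn)) valx drop_size_cat ?size_nseq //.
  (* The state at layer [k] depends only on the first [k] bits, all zero here. *)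
  rewrite (@robp_state_prefix _ _ _ (nseq_tuple n false)) => [|j jk].
    by have := gs _ gy; rewrite /from subKn // ltnW.
  by rewrite valx nth_cat size_nseq jk !nth_nseq jk (ltn_trans jk kn).
apply: le_trans Eg; rewrite mul1r; apply: expo_mono.
  by rewrite divr_ge0 ?ler0n.
exact: le_trans (vk _ ks) vP.
Qed.
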